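(* Let $(\zeta,\epsilon)$ be a pair of (possibly dependent) random variables with $\mathbf{P}(\epsilon=1)=q$, $\mathbf{P}(\epsilon=0)=1-q$, $0<q<1$, $\mathbf{P}(\zeta\ge 0)=1$ and $\mathbf{P}(\zeta=0)<1$. Let $(\zeta_n,\epsilon_n)_{n\ge1}$ be a sequence of independent copies of $(\zeta,\epsilon)$, and put $\nu=\min\{n\ge1:\epsilon_n=1\}$ and $S_\nu=\sum_{i=1}^{\nu}\zeta_i$. Put $F_{\zeta}(t)=\mathbf{P}(\zeta<t)$, $F_{\zeta,0}(t)=\mathbf{P}(\zeta<t,\ \epsilon=0)$, $F_S(t)=\mathbf{P}(S_\nu<t)$ and $P_S(t)=1-F_S(t)$. Then: (i) For all $t\ge 0$, the function $P_S$ satisfies the integral equation $$P_S(t)=1-F_\zeta(t)+\int_0^t P_S(t-x)\,dF_{\zeta,0}(x).$$ (ii) For all $z\ge 0$, the Laplace transforms $\psi(z)=\int_0^\infty e^{-zt}\,dF_\zeta(t)$, $\psi_0(z)=\int_0^\infty e^{-zt}\,dF_{\zeta,0}(t)$ and $\varphi(z)=\int_0^\infty e^{-zt}\,dF_S(t)$ satisfy $$\varphi(z)=\frac{\psi(z)-\psi_0(z)}{1-\psi_0(z)}.$$ (iii) If $\sigma^2=\mathbf{D}\zeta<\infty$ then, with $a=\mathbf{E}\zeta$ and $a_0=\mathbf{E}[\zeta I(\epsilon=0)]$, $$\mathbf{E}S_\nu=\frac{a}{q},\qquad \mathbf{D}S_\nu=\frac{\sigma^2}{q}+\frac{a^2(q-1)+2a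 a_0}{q^2}.$$
   Context: $\mathbf{D}$ denotes variance and $I(A)$ is the indicator of the event $A$. Distribution functions are taken in the left-continuous form $\mathbf{P}(X<t)$. Stieltjes integrals are integrals against the corresponding measures: $\int_0^t h(x)\,dF_{\zeta,0}(x)=\mathbf{E}[h(\zeta)I(\epsilon=0)I(\zeta<t)]$ (integration over $[0,t)$), and $\int_0^\infty$ is integration over $[0,\infty)$. *)

(* Defs.v *)
From HB Require Import structures.
From mathcomp Require Import all_boot all_order all_algebra.
From mathcomp Require Import finmap.
From mathcomp Require Import all_classical all_reals all_analysis.

Set Implicit Arguments.
Unset Strict Implicit.
Unset Printing Implicit Defensive.
Import Order.TTheory GRing.Theory Num.Theory.
Import numFieldNormedType.Exports.

Local Open Scope classical_set_scope.
Local Open Scope ring_scope.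

Section laws.
Context d d' (T : measurableType d) (T' : measurableType d') (R : realType).
Variable P : probability T R.

Definition same_law (X Y : T -> T') : Prop :=
  forall B : set T', measurable B -> P (X @^-1` B) = P (Y @^-1` B).

Definition mutually_independent (I : choiceType) (D : set I)
    (X : I -> T -> T') : Prop :=
  forall (J : {fset I}) (B : I -> set T'),
    [set` J] `<=` D -> (forall i, measurable (B i)) ->
    P (\bigcap_(i in [set` J]) (X i @^-1` B i)) =
    (\prod_(i <- J) P (X i @^-1` B i))%E.

End laws.

Section real_laws.
Context d (T : measurableType d) (R : realType) (P : probability T R).

(* Left-continuous convention, unlike [cdf]. *)
Definition lcdf (X : T -> R) (t : R) : R := fine (P [set w | X w < t]).

Lemma measurable_preim1 (X : {RV P >-> R}) (c : R) :
  measurable [set w | X w = c].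
Proof.
rewrite -[X in measurable X]setTI.
exact: (measurable_funPT X) measurableT _ (measurable_set1 c).
Qed.

Definition law_on (X Y : {RV P >-> R}) (c : R) : set R -> \bar R :=
  fun B => P [set w | B (X w) /\ Y w = c].

Section law_on_measure.
Variables (X Y : {RV P >-> R}) (c : R).

Let law_onE : law_on X Y c = pushforward (mrestr P (measurable_preim1 Y c)) X.
Proof. by []. Qed.

Let mX : measurable_fun setT X. Proof. exact: (measurable_funPT X). Qed.

Let law_on0 : law_on X Y c set0 = 0%E.
Proof. by rewrite law_onE /pushforward preimage_set0 measure0. Qed.

Let law_on_ge0 B : (0 <= law_on X Y c B)%E.
Proof. exact: measure_ge0. Qed.

Let law_on_sigma_additive : semi_sigma_additive (law_on X Y c).
Proof.
move=> F mF tF mUF; rewrite law_onE /pushforward preimage_bigcup.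
apply: measure_semi_sigma_additive.
- by move=> n; rewrite -[X in measurable X]setTI; exact: mX.
- apply/trivIsetP => /= i j _ _ ij; rewrite -preimage_setI.
  by move/trivIsetP : tF => /(_ _ _ _ _ ij) ->//; rewrite preimage_set0.
- by rewrite -preimage_bigcup -[X in measurable X]setTI; exact: mX.
Qed.

HB.instance Definition _ := isMeasure.Build _ _ _ (law_on X Y c)
  law_on0 law_on_ge0 law_on_sigma_additive.

End law_on_measure.

Lemma law_on_lt (X Y : {RV P >-> R}) (c t : R) :
  law_on X Y c `]-oo, t[ = P [set w | X w < t /\ Y w = c].
Proof. by []. Qed.

End real_laws.

Definition laplace (R : realType) (mu : {measure set R -> \bar R}) (z : R) : R :=
  \int[mu]_(t in `[0, +oo[) expR (- (z * t)).

Section first_one.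
Variable R : realType.

(* The least n >= 1 with e n = 1; the value 0 stands for min of the empty set. *)
Definition first_one (e : nat -> R) : nat :=
  match pselect (exists n, (0 < n)%N && (e n == 1)) with
  | left exn => ex_minn exn
  | right _ => 0%N
  end.

Lemma first_one_eqS (e : nat -> R) (n : nat) :
  first_one e = n.+1 <->
  e n.+1 = 1 /\ (forall k, (k < n)%N -> e k.+1 <> 1).
Proof.
rewrite /first_one; case: pselect => [exn|nexn].
  case: ex_minnP => m /andP[m0 /eqP em] min; split.
    move=> mE; rewrite -mE; split=> // k kn ek.
    by have := min k.+1; rewrite ek eqxx /= => /(_ isT); rewrite mE ltnS leqNgt kn.
  move=> [en nk]; apply/eqP; rewrite eqn_leq; apply/andP; split.
    by apply: min; rewrite en eqxx.
  case: m m0 em {min} => // m _ em; rewrite ltnS leqNgt; apply/negP => mn.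
  exact: nk em.
by split => // -[en _]; case: nexn; exists n.+1; rewrite en eqxx.
Qed.

Lemma first_one_eq0 (e : nat -> R) :
  first_one e = 0%N <-> forall k, e k.+1 <> 1.
Proof.
rewrite /first_one; case: pselect => [exn|nexn].
  case: ex_minnP => m /andP[m0 /eqP em] _; split => [m00|]; first by rewrite m00 in m0.
  by case: m m0 em => // m _ em /(_ m).
by split => // _ k ek; case: nexn; exists k.+1; rewrite ek eqxx.
Qed.

End first_one.

Section stopped_sum.
Context d (T : measurableType d) (R : realType) (P : probability T R).
Variables (zeta eps : nat -> {RV P >-> R}).

Definition stopping_index (w : T) : nat := first_one (eps ^~ w).

Definition stopped_sum (w : T) : R :=
  \sum_(1 <= i < (stopping_index w).+1) zeta i w.

Lemma measurable_stopping_index n :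
  measurable (stopping_index @^-1` [set n]).
Proof.
have mN k : measurable (~` [set w | eps k w = 1]).
  by apply: measurableC; exact: measurable_preim1.
case: n => [|n].
  rewrite (_ : _ @^-1` _ = \bigcap_k ~` [set w | eps k.+1 w = 1]).
    by apply: bigcap_measurableType.
  apply/seteqP; split => w /=.
    by move/first_one_eq0 => h k _; exact: h.
  by move=> h; apply/first_one_eq0 => k; exact: h.
rewrite (_ : _ @^-1` _ = [set w | eps n.+1 w = 1] `&`
    \bigcap_(k in `I_n) ~` [set w | eps k.+1 w = 1]).
  apply: measurableI; first exact: measurable_preim1.
  by apply: bigcap_measurableType.
apply/seteqP; split => w /=.
  by move/first_one_eqS.
by move=> h; apply/first_one_eqS.
Qed.

Lemma measurable_stopped_sum : measurable_fun setT stopped_sum.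
Proof.
move=> _ B mB; rewrite setTI.
rewrite (_ : _ @^-1` _ = \bigcup_n ((stopping_index @^-1` [set n]) `&`
    (fun w => \sum_(1 <= i < n.+1) zeta i w) @^-1` B)).
  apply: bigcup_measurable => n _; apply: measurableI.
    exact: measurable_stopping_index.
  rewrite -[X in measurable X]setTI.
  by apply: (@measurable_sum _ _ _ setT _ _ (fun i => zeta i)).
apply/seteqP; split => w /=.
  by move=> Bw; exists (stopping_index w).
by move=> [n _ [<-]].
Qed.

HB.instance Definition _ :=
  isMeasurableFun.Build _ _ _ _ stopped_sum measurable_stopped_sum.

End stopped_sum.

(* Main.v *)
Require Import Defs.
From HB Require Import structures.
From mathcomp Require Import all_boot all_order all_algebra finmap.
From mathcomp Require Import all_classical all_reals all_analysis.
From mathcomp Require Import measurable_realfun ring lra.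

Set Implicit Arguments.
Unset Strict Implicit.
Unset Printing Implicit Defensive.
Import Order.TTheory GRing.Theory Num.Theory.
Import numFieldNormedType.Exports.

Local Open Scope classical_set_scope.
Local Open Scope ring_scope.

(** The sum [S] restarts after its first term: if [eps 1 = 1] then
    [S = zeta 1], and otherwise [S = zeta 1 + S'] where [S'] is a copy of [S]
    independent of the first pair. Hence, for every measurable [h >= 0],

      E h(S) = E[h(zeta); eps = 1] + E[H(zeta); eps <> 1],  H x = E h(x + S),

    which is [renewal_equation]. The three claims are this equation for
    particular functions [h].

    - The indicator of [[t, +oo[] gives the integral equation for the tail. On
      [zeta >= t] the inner probability is [1], because [S >= 0] almost surely;
      this last fact is again an instance, since the indicator of the negative
      reals gives [P(S < 0) <= (1 - q) P(S < 0)].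
    - The function [x |-> exp (- z x)] is multiplicative, so that the equation
      reads [phi = (psi - psi0) + psi0 phi], and [psi0 <= 1 - q < 1].
    - The functions [x |-> |x|] and [x |-> x ^ 2] give linear equations for the
      first two moments of [S], which determine them as soon as they are finite.
      Finiteness comes from the truncations [min (x ^ 2) K], whose means are
      finite and satisfy a contraction inequality with a factor [1 - q ^ 2],
      hence are bounded uniformly in [K].

    To prove the renewal equation without constructing the copy [S'], let [pass]
    be the operator taking [h] to [y |-> E[h(y + zeta); eps <> 1]] and [stop] the
    one with [eps = 1] instead. Peeling off the last term of the sum, which is
    independent of the past, shows that [E h(y + S)] is the series of the
    [pass ^ k (stop h) y] ([integral_stopped_sum_series]); the equation is then
    the splitting of this series after its first term. *)

(** * Independence of a Markov chain from its future innovations *)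

Section independence.
Local Open Scope ereal_scope.
Context d (T : measurableType d) (R : realType) (P : probability T R).

(** The two sides are finite measures in [M] that agree on rectangles, and
    rectangles form a pi-system generating the product sigma-algebra. *)
Lemma indep_event_pair d1 d2 (T1 : measurableType d1) (T2 : measurableType d2)
    (U : T -> T1) (V : T -> T2) (E : set T) :
  measurable_fun setT U -> measurable_fun setT V -> measurable E ->
  (forall A B, measurable A -> measurable B ->
    P ((U @^-1` A `&` V @^-1` B) `&` E) =
    P (U @^-1` A `&` V @^-1` B) * P E) ->
  forall M, measurable M ->
    P ((fun w => (U w, V w)) @^-1` M `&` E) =
    P ((fun w => (U w, V w)) @^-1` M) * P E.
Proof.
move=> mU mV mE UVE M mM.
have mUV : measurable_fun setT (fun w => (U w, V w)).
  exact: measurable_fun_pair.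
pose UV : {RV P >-> (T1 * T2)%type} := mfun_Sub (mem_set mUV).
have PE0 : (0 <= fine (P E))%R by exact: fine_ge0.
pose m1 : {measure set _ -> \bar R} :=
  pushforward (mrestr P mE) UV.
pose m2 : {measure set _ -> \bar R} := mscale (NngNum PE0) (distribution P UV).
have m2E A : m2 A = P ((fun w => (U w, V w)) @^-1` A) * P E.
  by rewrite /m2 /= /mscale /= fineK ?fin_num_measure// muleC.
rewrite -m2E -[LHS]/(m1 mUV M).
apply: (measure_unique
  [set A `*` B | A in @measurable _ T1 & B in @measurable _ T2]
  (fun=> setT) _ _ _ _ (m1 mUV) m2) => //.
- by rewrite measurable_prod_measurableType.
- move=> _ _ [A mA [B mB <-]] [A' mA' [B' mB' <-]].
  exists (A `&` A'); first exact: measurableI.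
  by exists (B `&` B'); [exact: measurableI|rewrite setXI].
- by move=> _; exists setT => //; exists setT => //; rewrite setXTT.
- by rewrite bigcup_const//; exists 0%N.
- by move=> _ [A mA [B mB <-]]; rewrite m2E -UVE.
- move=> _; rewrite /m1 /= /pushforward preimage_setT /mrestr setTI.
  by rewrite ltey_eq fin_num_measure.
Qed.

(** The joint law of [(U, V)] is the product of the laws of [U] and [V'], so
    Tonelli's theorem applies. Having [V'] with the law of [V] in the inner
    integral allows the generic pair to replace each of its copies. *)
Lemma integral_indep_pair d1 d2 (T1 : measurableType d1)
    (T2 : measurableType d2) (U : T -> T1) (V V' : T -> T2)
    (g : T1 * T2 -> \bar R) :
  measurable_fun setT U -> measurable_fun setT V -> measurable_fun setT V' ->
  (forall A B, measurable A -> measurable B ->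
    P (U @^-1` A `&` V @^-1` B) = P (U @^-1` A) * P (V' @^-1` B)) ->
  measurable_fun setT g -> (forall x, 0 <= g x) ->
  \int[P]_w g (U w, V w) = \int[P]_w \int[P]_w' g (U w, V' w').
Proof.
move=> mU mV mV' UV mg g0.
have mUV : measurable_fun setT (fun w => (U w, V w)).
  exact: measurable_fun_pair.
pose X : {RV P >-> T1} := mfun_Sub (mem_set mU).
pose Y : {RV P >-> T2} := mfun_Sub (mem_set mV').
pose XV : {RV P >-> (T1 * T2)%type} := mfun_Sub (mem_set mUV).
have -> : \int[P]_w g (U w, V w) = \int[distribution P XV]_z g z.
  by rewrite ge0_integral_distribution.
have -> : \int[distribution P XV]_z g z =
    \int[distribution P X \x distribution P Y]_z g z.
  by apply: eq_measure_integral => A mA _; exact/esym/product_measure_unique.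
rewrite fubini_tonelli1// /fubini_F ge0_integral_distribution//; last 2 first.
- exact: measurable_fun_fubini_tonelli_F.
- by move=> x; exact: integral_ge0.
apply: eq_integral => w _ /=.
rewrite ge0_integral_distribution//.
exact: measurable_fun_pair2.
Qed.

(** The induction on [k] has to carry all finite families of later variables: the
    step moves [X k.+1] from the future to the past, which uses the induction
    hypothesis both for the event [E] on the variables after [k.+1] and for [E]
    together with a condition on [X k.+1]. *)
Lemma chain_indep d1 d2 (T1 : measurableType d1) (T2 : measurableType d2)
    (X : nat -> T -> T2) (U : nat -> T -> T1) (phi : T1 * T2 -> T1) (u0 : T1) :
  (forall n, measurable_fun setT (X n)) ->
  mutually_independent P [set n | (1 <= n)%N] X ->
  measurable_fun setT phi ->
  (forall w, U 0%N w = u0) ->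
  (forall n w, U n.+1 w = phi (U n w, X n.+1 w)) ->
  forall k (A : set T1) (J : {fset nat}) (B : nat -> set T2),
    measurable A -> (forall i, measurable (B i)) ->
    (forall i, i \in J -> (k < i)%N) ->
    P (U k @^-1` A `&` \bigcap_(i in [set` J]) (X i @^-1` B i)) =
    P (U k @^-1` A) * P (\bigcap_(i in [set` J]) (X i @^-1` B i)).
Proof.
move=> mX indep mphi U0 US.
have mpre n C : measurable C -> measurable (X n @^-1` C).
  by move=> mC; rewrite -[X in measurable X]setTI; exact: mX.
have mU n : measurable_fun setT (U n).
  elim: n => [|n IH].
    by rewrite (_ : U 0%N = cst u0)//; exact/funext.
  rewrite (_ : U n.+1 = phi \o (fun w => (U n w, X n.+1 w))); last first.
    exact/funext.
  by apply: measurableT_comp => //; exact: measurable_fun_pair.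
have mcap (J : {fset nat}) (B : nat -> set T2) :
    (forall i, measurable (B i)) ->
    measurable (\bigcap_(i in [set` J]) (X i @^-1` B i)).
  move=> mB; apply: bigcap_measurableType => i _; exact: mpre.
elim => [|k IH] A J B mA mB kJ.
  have [Au|nAu] := pselect (A u0).
    have -> : U 0%N @^-1` A = setT by apply/seteqP; split => w //= _; rewrite U0.
    by rewrite setTI probability_setT mul1e.
  have -> : U 0%N @^-1` A = set0.
    by apply/seteqP; split => w //=; rewrite U0.
  by rewrite set0I measure0 mul0e.
set E := \bigcap_(i in _) _.
have mE : measurable E by exact: mcap.
have kJ' : k.+1 \notin J by apply/negP => /kJ; rewrite ltnn.
(* a condition on [X k.+1] turns [E] into an event of the same form *)
have capU C : X k.+1 @^-1` C `&` E =
    \bigcap_(i in [set` (k.+1 |` J)%fset])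
      (X i @^-1` (if i == k.+1 then C else B i)).
  apply/seteqP; split => [w /= [Cw Ew] i /=|w /= Ew].
    rewrite !inE => /orP[/eqP ->|iJ]; first by rewrite eqxx.
    case: eqP => [ik|_]; last exact: Ew.
    by move: kJ'; rewrite -ik iJ.
  split; first by have := Ew k.+1; rewrite /= !inE eqxx; exact.
  move=> i /= iJ; have := Ew i; rewrite /= !inE iJ orbT => /(_ isT).
  by case: eqP => // ik; move: kJ'; rewrite -ik iJ.
have PcapU C : measurable C ->
    P (X k.+1 @^-1` C `&` E) = P (X k.+1 @^-1` C) * P E.
  move=> mC; rewrite capU indep.
  - rewrite big_fsetU1//= eqxx; congr (_ * _).
    rewrite /E indep//; last by move=> i /= /kJ; apply: leq_trans.
    rewrite [LHS]big_seq [RHS]big_seq; apply: eq_bigr => i iJ.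
    by case: eqP => // ik; move: kJ'; rewrite -ik iJ.
  - by move=> i /=; rewrite !inE => /orP[/eqP ->//|/kJ]; apply: leq_trans.
  - by move=> i; case: ifP.
have IH1 (A' : set T1) C : measurable A' -> measurable C ->
    P (U k @^-1` A' `&` (X k.+1 @^-1` C `&` E)) =
    P (U k @^-1` A') * P (X k.+1 @^-1` C `&` E).
  move=> mA' mC; rewrite capU IH// => i; first by case: ifP.
  by rewrite !inE => /orP[/eqP ->//|/kJ]; apply: leq_trans.
have IH2 (A' : set T1) C : measurable A' -> measurable C ->
    P (U k @^-1` A' `&` X k.+1 @^-1` C) =
    P (U k @^-1` A') * P (X k.+1 @^-1` C).
  move=> mA' mC.
  have := IH A' [fset k.+1]%fset (fun=> C) mA' (fun=> mC).
  rewrite set_fset1 bigcap_set1; apply => i; rewrite inE => /eqP ->//.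
rewrite (_ : U k.+1 @^-1` A =
    (fun w => (U k w, X k.+1 w)) @^-1` (phi @^-1` A)); last first.
  by apply/seteqP; split => w /=; rewrite US.
apply: indep_event_pair => //.
  move=> A' C mA' mC.
  by rewrite -setIA IH1// IH2// PcapU// muleA.
by rewrite -[X in measurable X]setTI; exact: mphi.
Qed.

Lemma chain_indep_next d1 d2 (T1 : measurableType d1) (T2 : measurableType d2)
    (X : nat -> T -> T2) (U : nat -> T -> T1) (phi : T1 * T2 -> T1) (u0 : T1) :
  (forall n, measurable_fun setT (X n)) ->
  mutually_independent P [set n | (1 <= n)%N] X ->
  measurable_fun setT phi ->
  (forall w, U 0%N w = u0) ->
  (forall n w, U n.+1 w = phi (U n w, X n.+1 w)) ->
  forall k (A : set T1) (B : set T2), measurable A -> measurable B ->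
    P (U k @^-1` A `&` X k.+1 @^-1` B) =
    P (U k @^-1` A) * P (X k.+1 @^-1` B).
Proof.
move=> mX indep mphi U0 US k A B mA mB.
have := chain_indep mX indep mphi U0 US (k := k)
  (J := [fset k.+1]%fset) mA (fun=> mB).
by rewrite set_fset1 bigcap_set1; apply => i; rewrite inE => /eqP ->.
Qed.

End independence.

(** * The renewal equation *)

Section renewal.
Local Open Scope ereal_scope.
Context d (T : measurableType d) (R : realType) (P : probability T R).

Section marked_shift.
Variables zeta eps : {RV P >-> R}.

Definition marked_shift (D : set R) (h : R -> \bar R) (y : R) : \bar R :=
  \int[P]_(w in eps @^-1` D) h (y + zeta w)%R.

Lemma measurable_mem_set (D : set R) :
  measurable D -> measurable_fun setT (fun x : R => x \in D).
Proof.
move=> mD; apply: (measurable_fun_bool true); rewrite setTI.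
rewrite (_ : _ @^-1` _ = D)//.
by apply/seteqP; split => x /= => [/set_mem|/mem_set].
Qed.

Lemma marked_shift_ge0 D h y : (forall x, 0 <= h x) -> 0 <= marked_shift D h y.
Proof. by move=> h0; exact: integral_ge0. Qed.

Lemma measurable_marked_shift D h : measurable D ->
  measurable_fun setT h -> (forall x, 0 <= h x) ->
  measurable_fun setT (marked_shift D h).
Proof.
move=> mD mh h0.
pose f (z : R * T) := if eps z.2 \in D then h (z.1 + zeta z.2)%R else 0.
rewrite (_ : marked_shift D h = fubini_F P f); last first.
  apply/funext => y; rewrite /marked_shift integral_mkcond.
  apply: eq_integral => w _; rewrite /patch /f /=.
  congr (if _ then _ else _); apply/idP/idP; rewrite !inE//.
apply: measurable_fun_fubini_tonelli_F; last by move=> z; rewrite /f; case: ifP.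
apply: measurable_fun_ifT => //.
- apply: (measurableT_comp (measurable_mem_set mD)).
  exact: measurableT_comp measurable_snd.
- apply: measurableT_comp => //; apply: measurable_funD => //.
  exact: measurableT_comp measurable_snd.
Qed.

Lemma marked_shift_cst D (c : R) y : measurable D ->
  marked_shift D (cst c%:E) y = c%:E * P (eps @^-1` D).
Proof.
by move=> mD; rewrite /marked_shift integral_cst//; exact: measurable_funPTI.
Qed.

End marked_shift.

Variables (zeta eps : {RV P >-> R}) (zeta_ eps_ : nat -> {RV P >-> R}).
Hypothesis copies : forall n, (1 <= n)%N ->
  same_law P (fun w => (zeta_ n w, eps_ n w)) (fun w => (zeta w, eps w)).
Hypothesis indep : mutually_independent P [set n : nat | (1 <= n)%N]
  (fun n w => (zeta_ n w, eps_ n w)).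

Local Notation S := (stopped_sum zeta_ eps_).

Definition alive k := [set w | forall j, (j < k)%N -> eps_ j.+1 w <> 1%R].

Definition partial_sum k w : R := (\sum_(1 <= i < k.+1) zeta_ i w)%R.

Lemma alive0 : alive 0 = setT.
Proof. by apply/seteqP; split. Qed.

Lemma aliveS k : alive k.+1 = alive k `&` eps_ k.+1 @^-1` (~` [set 1%R]).
Proof.
apply/seteqP; split => w /=.
  by move=> kw; split; [move=> j jk; apply: kw; exact: ltnW|exact: kw].
by move=> [kw nw] j; rewrite ltnS leq_eqVlt => /orP[/eqP ->//|/kw].
Qed.

Lemma partial_sum0 w : partial_sum 0 w = 0%R.
Proof. by rewrite /partial_sum big_geq. Qed.

Lemma partial_sumS k w :
  partial_sum k.+1 w = (partial_sum k w + zeta_ k.+1 w)%R.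
Proof. by rewrite /partial_sum big_nat_recr. Qed.

Lemma measurable_alive k : measurable (alive k).
Proof.
elim: k => [|k IH]; first by rewrite alive0.
rewrite aliveS; apply: measurableI => //; apply: measurable_funPTI.
exact: measurableC.
Qed.

Lemma measurable_partial_sum k : measurable_fun setT (partial_sum k).
Proof. exact: measurable_sum. Qed.

(** One step of the walk: the pair (partial sum, still alive) is a chain driven by
    the pairs [(zeta_ n, eps_ n)], hence is independent of the next one, which
    can be integrated out first. *)
Lemma integral_alive_next D k h y : measurable D ->
  measurable_fun setT h -> (forall x, 0 <= h x) ->
  \int[P]_(w in alive k `&` eps_ k.+1 @^-1` D) h (y + partial_sum k.+1 w)%R =
  \int[P]_(w in alive k) marked_shift zeta eps D h (y + partial_sum k w)%R.
Proof.
move=> mD mh h0.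
pose X n w := (zeta_ n w, eps_ n w).
pose U n w := (partial_sum n w, w \in alive n).
pose phi (z : (R * bool) * (R * R)) : R * bool :=
  ((z.1.1 + z.2.1)%R, z.1.2 && (z.2.2 \in ~` [set 1%R])).
have m1 : measurable_fun setT (fun z : (R * bool) * (R * R) => z.1.1).
  exact: measurableT_comp measurable_fst measurable_fst.
have m2 : measurable_fun setT (fun z : (R * bool) * (R * R) => z.1.2).
  exact: measurableT_comp measurable_snd measurable_fst.
have m3 : measurable_fun setT (fun z : (R * bool) * (R * R) => z.2.1).
  exact: measurableT_comp measurable_fst measurable_snd.
have m4 : measurable_fun setT (fun z : (R * bool) * (R * R) => z.2.2).
  exact: measurableT_comp measurable_snd measurable_snd.
have mX n : measurable_fun setT (X n) by exact: measurable_fun_pair.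
have mphi : measurable_fun setT phi.
  apply: measurable_fun_pair; first exact: measurable_funD.
  apply: measurable_and => //.
  by apply: (measurableT_comp (measurable_mem_set _) m4); exact: measurableC.
have U0 w : U 0%N w = (0%R, true).
  by rewrite /U partial_sum0 alive0 in_setT.
have US n w : U n.+1 w = phi (U n w, X n.+1 w).
  by rewrite /U /phi /X /= partial_sumS aliveS in_setI.
have mU n : measurable_fun setT (U n).
  apply: measurable_fun_pair; first exact: measurable_partial_sum.
  apply: (measurable_fun_bool true); rewrite setTI.
  rewrite (_ : _ @^-1` _ = alive n); first exact: measurable_alive.
  by apply/seteqP; split => w /= => [/set_mem|/mem_set].
pose g (z : (R * bool) * (R * R)) : \bar R :=
  if z.1.2 && (z.2.2 \in D) then h (y + z.1.1 + z.2.1)%R else 0.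
have mg : measurable_fun setT g.
  apply: measurable_fun_ifT => //.
    by apply: measurable_and => //; exact: (measurableT_comp (measurable_mem_set mD)).
  apply: measurableT_comp => //.
  by do 2 apply: measurable_funD => //.
have g0 z : 0 <= g z by rewrite /g; case: ifP.
have mV : measurable_fun setT (fun w => (zeta w, eps w)).
  exact: measurable_fun_pair.
transitivity (\int[P]_w g (U k w, X k.+1 w)).
  rewrite integral_mkcond; apply: eq_integral => w _.
  rewrite /patch /g /= in_setI partial_sumS addrA.
  by congr (if _ && _ then _ else _); apply/idP/idP; rewrite !inE.
rewrite (integral_indep_pair (mU k) (mX k.+1) mV)//; last first.
  move=> A B mA mB.
  rewrite (chain_indep_next mX indep mphi U0 US)//; congr (_ * _).
  exact: copies.
rewrite [RHS]integral_mkcond; apply: eq_integral => w _.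
rewrite /patch /g /=; case: ifPn => wk /=; last exact: integral0.
rewrite /marked_shift [RHS]integral_mkcond; apply: eq_integral => w' _.
by rewrite /patch; congr (if _ then _ else _); apply/idP/idP; rewrite !inE.
Qed.

Local Notation pass := (marked_shift zeta eps (~` [set 1%R])).
Local Notation stop := (marked_shift zeta eps [set 1%R]).

Let mN1 : measurable (~` [set 1%R] : set R).
Proof. exact: measurableC. Qed.

Lemma iter_pass_ge0 k h y : (forall x, 0 <= h x) -> 0 <= iter k pass h y.
Proof.
by elim: k h y => [|k IH] h y h0 //=; apply: marked_shift_ge0 => x; exact: IH.
Qed.

Lemma measurable_iter_pass k h : measurable_fun setT h ->
  (forall x, 0 <= h x) -> measurable_fun setT (iter k pass h).
Proof.
elim: k h => [|k IH] h mh h0 //=.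
apply: measurable_marked_shift => // x; first exact: IH.
exact: iter_pass_ge0.
Qed.

Lemma integral_alive k h y : measurable_fun setT h -> (forall x, 0 <= h x) ->
  \int[P]_(w in alive k) h (y + partial_sum k w)%R = iter k pass h y.
Proof.
elim: k h y => [|k IH] h y mh h0.
  rewrite alive0 -[RHS]mule1 -(probability_setT P) -integral_cst//.
  by apply: eq_integral => w _; rewrite partial_sum0 addr0.
rewrite aliveS integral_alive_next// iterSr IH//.
- exact: measurable_marked_shift.
- by move=> x; exact: marked_shift_ge0.
Qed.

Variable q : R.
Hypothesis q01 : (0 < q < 1)%R.
Hypothesis eps1 : P [set w | eps w = 1%R] = q%:E.

Lemma prob_pass : P (eps @^-1` (~` [set 1%R])) = (1 - q)%:E.
Proof.
rewrite (_ : _ @^-1` _ = ~` [set w | eps w = 1%R])//.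
by rewrite probability_setC ?eps1//; exact: (measurable_funPTI eps (measurable_set1 _)).
Qed.

Lemma prob_alive k : P (alive k) = ((1 - q) ^+ k)%:E.
Proof.
have -> : P (alive k) = \int[P]_(w in alive k) cst 1 (0 + partial_sum k w)%R.
  by rewrite integral_cst ?mul1e//; exact: measurable_alive.
rewrite integral_alive//.
have : forall y : R, iter k pass (cst 1) y = ((1 - q) ^+ k)%:E; last exact.
elim: k => [|k IH] y; first by rewrite expr0.
rewrite iterS (_ : iter k pass _ = cst ((1 - q) ^+ k)%:E); last exact/funext.
by rewrite marked_shift_cst// prob_pass -EFinM exprSr.
Qed.

(** The walk survives [k] steps with probability [(1 - q) ^ k], which tends to
    [0]; so the default value [0] of [stopping_index] does not affect means. *)
Lemma prob_no_stop : P (stopping_index eps_ @^-1` [set 0%N]) = 0.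
Proof.
have mE := measurable_stopping_index eps_ 0.
set E := _ @^-1` _ in mE *.
have Ek k : P E <= ((1 - q) ^+ k)%:E.
  rewrite -prob_alive le_measure ?inE//; first exact: measurable_alive.
  by move=> w /= /first_one_eq0 h j _; exact: h.
apply/eqP; rewrite eq_le measure_ge0 andbT.
have PE : P E = (fine (P E))%:E by rewrite fineK// fin_num_measure.
rewrite PE lee_fin.
have q1 : (`|1 - q| < 1)%R by case/andP: q01 => *; rewrite ltr_norml; lra.
rewrite -(cvg_lim (@Rhausdorff R) (cvg_expr q1)).
apply: limr_ge; first by apply/cvg_ex; exists 0%R; exact: cvg_expr.
by near=> k; rewrite -lee_fin -PE.
Unshelve. all: by end_near.
Qed.

(** Decomposition along the value [k.+1] of the stopping index: the walk passes
    [k] times and then stops. *)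
Lemma integral_stopped_sum_series h y :
  measurable_fun setT h -> (forall x, 0 <= h x) ->
  \int[P]_w h (y + S w)%R = \sum_(k <oo) iter k pass (stop h) y.
Proof.
move=> mh h0.
pose F n := stopping_index eps_ @^-1` [set n].
have mF n : measurable (F n) by exact: measurable_stopping_index.
have mf : measurable_fun setT (fun w => h (y + S w)%R).
  apply: measurableT_comp => //; apply: measurable_funD => //.
have UF : \bigcup_n F n = setT.
  by apply/seteqP; split => w // _; exists (stopping_index eps_ w).
rewrite -UF ge0_integral_bigcup//; last 2 first.
- by rewrite UF.
- by move=> i j _ _ [w [/= <- <-]].
have F0 n : 0 <= \int[P]_(w in F n) h (y + S w)%R by exact: integral_ge0.
rewrite [LHS]nneseries_recl//= null_set_integral//; last 2 first.
- exact: measurable_funTS.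
- exact: prob_no_stop.
rewrite add0e -[LHS](nneseries_addn 1)//; apply: eq_eseriesr => k _.
rewrite addn1.
have -> : F k.+1 = alive k `&` eps_ k.+1 @^-1` [set 1%R].
  apply/seteqP; split => w /=; first by move/first_one_eqS => [].
  by move=> [h1 h2]; exact/first_one_eqS.
transitivity (\int[P]_(w in alive k `&` eps_ k.+1 @^-1` [set 1%R])
   h (y + partial_sum k.+1 w)%R).
  apply: eq_integral => w; rewrite inE => -[/= h1 h2].
  rewrite /stopped_sum (_ : stopping_index eps_ w = k.+1)//.
  exact/first_one_eqS.
rewrite integral_alive_next// integral_alive//.
- exact: measurable_marked_shift.
- by move=> x; exact: marked_shift_ge0.
Qed.

(** In the series of the [iter k pass (stop h)], the first term accounts for an
    immediate stop, and the others are [pass] applied to the whole series. *)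
Lemma renewal_equation h : measurable_fun setT h -> (forall x, 0 <= h x) ->
  \int[P]_w h (S w) =
  \int[P]_(w in eps @^-1` [set 1%R]) h (zeta w) +
  \int[P]_(w in eps @^-1` (~` [set 1%R])) \int[P]_w' h (zeta w + S w')%R.
Proof.
move=> mh h0.
have mstop : measurable_fun setT (stop h) by exact: measurable_marked_shift.
have stop0 x : 0 <= stop h x by exact: marked_shift_ge0.
transitivity (\int[P]_w h (0 + S w)%R).
  by apply: eq_integral => w _; rewrite add0r.
rewrite integral_stopped_sum_series// nneseries_recl//; last first.
  by move=> k _; exact: iter_pass_ge0.
congr (_ + _).
  by apply: eq_integral => w _; rewrite add0r.
rewrite -(nneseries_addn 1)//; last by move=> k; exact: iter_pass_ge0.
under eq_eseriesr do rewrite addn1 iterS /marked_shift.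
rewrite -integral_nneseries//; last 3 first.
- exact: measurable_funPTI.
- move=> k; apply: measurable_funTS; apply: measurableT_comp.
    exact: measurable_iter_pass.
  exact: measurable_funD.
- by move=> k w _; exact: iter_pass_ge0.
by apply: eq_integral => w _; rewrite integral_stopped_sum_series// add0r.
Qed.

End renewal.

(** * Almost surely nonnegative random variables *)

Section conull.
Local Open Scope ereal_scope.
Context d (T : measurableType d) (R : realType).

Lemma ge0_integral_conull (mu : {measure set T -> \bar R}) (A D : set T)
    (f : T -> \bar R) :
  measurable A -> measurable D -> mu (~` A) = 0 ->
  measurable_fun setT f -> (forall w, 0 <= f w) ->
  \int[mu]_(w in D) f w = \int[mu]_(w in D `&` A) f w.
Proof.
move=> mA mD muA mf f0.
have mDA : measurable (D `&` A) by exact: measurableI.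
have mDC : measurable (D `&` ~` A) by apply: measurableI => //; exact: measurableC.
rewrite -{1}(setIT D) -(setUv A) setIUr.
rewrite ge0_integral_setU//; last 2 first.
- exact: measurable_funTS.
- by apply/disj_setPS => w [[_ ?] []].
rewrite [X in _ + X]null_set_integral ?adde0//.
  exact: measurable_funTS.
apply/eqP; rewrite eq_le measure_ge0 andbT -muA le_measure// ?inE//.
exact: measurableC.
Qed.

Variable P : probability T R.

(** The measure [law_on X Y c] is the image under [X] of the restriction of [P] to
    the event [Y = c]. *)
Lemma integral_law_on (X Y : {RV P >-> R}) (c : R) (D : set R) (f : R -> \bar R) :
  measurable D -> measurable_fun setT f -> (forall x, 0 <= f x) ->
  \int[law_on X Y c]_(x in D) f x =
  \int[P]_(w in X @^-1` D `&` Y @^-1` [set c]) f (X w).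
Proof.
move=> mD mf f0.
have mY : measurable [set w | Y w = c] := measurable_preim1 Y c.
have mXD : measurable (X @^-1` D) by exact: measurable_funPTI.
have mX : measurable_fun setT X by exact: measurable_funPT.
transitivity (\int[pushforward (mrestr P mY) X]_(x in D) f x).
  by apply: eq_measure_integral => A mA _.
rewrite ge0_integral_pushforward//; last exact: measurable_funTS.
rewrite (@ge0_integral_conull _ [set w | Y w = c])//.
- apply: eq_measure_integral => A mA AXY /=.
  by rewrite /mrestr setIidl// => w /AXY[].
- by rewrite /= /mrestr setICl measure0.
- exact: measurableT_comp.
- by move=> w /=.
Qed.

Lemma measurable_ge0 (X : {mfun T >-> R}) : measurable [set w | (0 <= X w)%R].
Proof.
rewrite (_ : [set w | _] = X @^-1` `[0%R, +oo[).
  exact: measurable_funPTI.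
by apply/seteqP; split => w /=; rewrite in_itv/= andbT.
Qed.

Lemma ge0_integral_eq_on_ge0 (X : {RV P >-> R}) (D : set T) (f g : R -> \bar R) :
  P (~` [set w | (0 <= X w)%R]) = 0 -> measurable D ->
  measurable_fun setT f -> (forall x, 0 <= f x) ->
  measurable_fun setT g -> (forall x, 0 <= g x) ->
  (forall x, (0 <= x)%R -> f x = g x) ->
  \int[P]_(w in D) f (X w) = \int[P]_(w in D) g (X w).
Proof.
move=> X0 mD mf f0 mg g0 fg; have mX := measurable_ge0 X.
rewrite (ge0_integral_conull mX mD X0 (measurableT_comp mf _)) => [||w]//=.
rewrite (ge0_integral_conull mX mD X0 (measurableT_comp mg _)) => [||w]//=.
by apply: eq_integral => w; rewrite inE => -[_ /fg].
Qed.

(** Expressing means through [`|X|] keeps all integrands nonnegative, as required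
    by the renewal equation. *)
Lemma expectation_norm (X : {mfun T >-> R}) :
  P (~` [set w | (0 <= X w)%R]) = 0 -> 'E_P[X] = \int[P]_w `|X w|%:E.
Proof.
move=> X0; rewrite unlock; apply: ae_eq_integral => //.
- exact/measurable_EFinP.
- by apply/measurable_EFinP; exact: measurableT_comp.
exists (~` [set w | (0 <= X w)%R]); split => //.
- by apply: measurableC; exact: measurable_ge0.
- by move=> w /= nw X0w; apply: nw => _; rewrite ger0_norm.
Qed.

Lemma nonneg_moments (X : {RV P >-> R}) (m v : R) :
  P (~` [set w | (0 <= X w)%R]) = 0 ->
  \int[P]_w `|X w|%:E = m%:E -> \int[P]_w (X w ^+ 2)%:E = v%:E ->
  'E_P[X] = m%:E /\ 'V_P[X] = (v - m ^+ 2)%:E.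
Proof.
move=> X0 Xm Xv.
have iX : P.-integrable setT (EFin \o X).
  apply/integrableP; split; first exact/measurable_EFinP.
  by under eq_integral do rewrite /= ; rewrite Xm ltry.
have iX2 : P.-integrable setT (EFin \o (X \* X)%R).
  apply/integrableP; split; first by apply/measurable_EFinP; exact: measurable_funM.
  rewrite (_ : integral _ _ _ = v%:E) ?ltry// -Xv; apply: eq_integral => w _ /=.
  by rewrite ger0_norm -?expr2// sqr_ge0.
have EX : 'E_P[X] = m%:E by rewrite expectation_norm.
split => //.
rewrite /variance covarianceE; [|exact/Lfun1_integrable..].
by rewrite EX -EFinM [RHS]EFinD -Xv unlock expr2 EFinN.
Qed.

Lemma norm_integral_lty (X : {RV P >-> R}) :
  \int[P]_w (X w ^+ 2)%:E < +oo -> \int[P]_w `|X w|%:E < +oo.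
Proof.
move=> X2; have mX2 : measurable_fun setT (fun w => (X w ^+ 2)%:E : \bar R).
  by apply/measurable_EFinP; exact: measurable_funX.
apply: (@le_lt_trans _ _ (\int[P]_w (cst 1 w + (X w ^+ 2)%:E))).
  apply: ge0_le_integral => //.
  - by apply/measurable_EFinP; exact: measurableT_comp.
  - exact: emeasurable_funD.
  - move=> w _; rewrite -EFinD lee_fin.
    by rewrite -[X in (_ <= 1 + X)%R]real_normK ?num_real//; nra.
rewrite ge0_integralD//; last by move=> w _; rewrite lee_fin sqr_ge0.
by rewrite integral_cst//= probability_setT mule1 lte_add_pinfty ?ltry.
Qed.

(** The centring constant [c] of the variance is a real number even if the mean is
    infinite ([fine] then returns [0]), so that [x ^ 2 <= 2 (x - c) ^ 2 + 2 c ^ 2]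
    gives the bound in all cases. *)
Lemma sqr_integral_lty (X : {RV P >-> R}) :
  'V_P[X] < +oo -> \int[P]_w (X w ^+ 2)%:E < +oo.
Proof.
rewrite /variance unlock; set c := fine _; rewrite unlock => V.
have mc : measurable_fun setT (fun w => ((X w - c) ^+ 2)%:E).
  by apply/measurable_EFinP; apply: measurable_funX; exact: measurable_funB.
have V' : \int[P]_w ((X w - c) ^+ 2)%:E < +oo.
  by apply: le_lt_trans V.
apply: (@le_lt_trans _ _
  (\int[P]_w (2%:E * ((X w - c) ^+ 2)%:E + (2 * c ^+ 2)%:E))).
  apply: ge0_le_integral => //.
  - by move=> w _; rewrite lee_fin sqr_ge0.
  - by apply/measurable_EFinP; exact: measurable_funX.
  - by apply: emeasurable_funD => //; exact: measurable_funeM.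
  - move=> w _; rewrite -EFinM -EFinD lee_fin.
    by have := sqr_ge0 (X w - 2 * c)%R; nra.
rewrite ge0_integralD//.
- rewrite ge0_integralZl//; last by move=> w _; rewrite lee_fin sqr_ge0.
  rewrite integral_cst//= probability_setT mule1.
  by rewrite lte_add_pinfty ?ltry// lte_mul_pinfty.
- by move=> w _; rewrite -EFinM lee_fin mulr_ge0// sqr_ge0.
- exact: measurable_funeM.
- by move=> w _; rewrite lee_fin mulr_ge0// sqr_ge0.
Qed.

End conull.

(** * The stopped sum *)

Section consequences.
Local Open Scope ereal_scope.
Context d (T : measurableType d) (R : realType) (P : probability T R).
Variables (zeta eps : {RV P >-> R}) (zeta_ eps_ : nat -> {RV P >-> R}) (q : R).
Hypothesis q01 : (0 < q < 1)%R.
Hypothesis eps1 : P [set w | eps w = 1%R] = q%:E.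
Hypothesis eps0 : P [set w | eps w = 0%R] = (1 - q)%:E.
Hypothesis zeta_ge0 : P [set w | (0 <= zeta w)%R] = 1.
Hypothesis copies : forall n, (1 <= n)%N ->
  same_law P (fun w => (zeta_ n w, eps_ n w)) (fun w => (zeta w, eps w)).
Hypothesis indep : mutually_independent P [set n : nat | (1 <= n)%N]
  (fun n w => (zeta_ n w, eps_ n w)).

Local Notation S := (stopped_sum zeta_ eps_).
Local Notation E1 := (eps @^-1` [set 1%R]).
Local Notation E0 := (eps @^-1` [set 0%R]).
Local Notation N := (eps @^-1` (~` [set 1%R])).
Local Notation Z := [set w | (0 <= zeta w)%R].

Let mE1 : measurable E1. Proof. exact: measurable_preim1. Qed.
Let mE0 : measurable E0. Proof. exact: measurable_preim1. Qed.
Let mN : measurable N. Proof. exact: measurableC. Qed.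
Let mZ : measurable Z. Proof. exact: measurable_ge0. Qed.

Lemma zeta_lt0_null : P (~` Z) = 0.
Proof. by rewrite probability_setC// zeta_ge0 subee. Qed.

Lemma mark_conull : P (~` (E0 `|` E1)) = 0.
Proof.
rewrite probability_setC; last exact: measurableU.
suff -> : P (E0 `|` E1) = 1 by rewrite subee.
have <- : P E0 + P E1 = 1.
  by rewrite (eps0 : P E0 = _) (eps1 : P E1 = _) -EFinD subrK.
apply: measureU => //.
by apply/seteqP; split => w //= -[-> /eqP]; rewrite eq_sym oner_eq0.
Qed.

(** [eps] is almost surely [0] or [1], and the stopping rule only tests [eps <> 1]. *)
Lemma integral_neq1 f : measurable_fun setT f -> (forall w, 0 <= f w) ->
  \int[P]_(w in N) f w = \int[P]_(w in E0) f w.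
Proof.
move=> mf f0; have mE01 : measurable (E0 `|` E1) by exact: measurableU.
rewrite (ge0_integral_conull mE01 mN mark_conull)//; congr (integral _ _ _).
apply/seteqP; split => w /=; first by move=> [n1 []].
by move=> w0; split; [rewrite w0 => /eqP; rewrite eq_sym oner_eq0|left].
Qed.

Lemma integral_split f : measurable_fun setT f -> (forall w, 0 <= f w) ->
  \int[P]_w f w = \int[P]_(w in E1) f w + \int[P]_(w in E0) f w.
Proof.
move=> mf f0; rewrite -integral_neq1// -ge0_integral_setU//.
- by rewrite -preimage_setU setUv.
- exact: measurable_funTS.
- by apply/disj_setPS => w [].
Qed.

Lemma measurable_shifted_mean h : measurable_fun setT h -> (forall x, 0 <= h x) ->
  measurable_fun setT (fun x : R => \int[P]_w h (x + S w)%R).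
Proof.
move=> mh h0.
apply: (measurable_fun_fubini_tonelli_F (fun z : R * T => h (z.1 + S z.2)%R)) => //.
apply: measurableT_comp => //; apply: measurable_funD; first exact: measurable_fst.
exact: measurableT_comp measurable_snd.
Qed.

Lemma renewal_equation0 h : measurable_fun setT h -> (forall x, 0 <= h x) ->
  \int[P]_w h (S w) =
  \int[P]_(w in E1) h (zeta w) +
  \int[P]_(w in E0) \int[P]_w' h (zeta w + S w')%R.
Proof.
move=> mh h0; rewrite (renewal_equation copies indep q01 eps1)//.
rewrite integral_neq1//; last by move=> w; exact: integral_ge0.
exact: measurableT_comp (measurable_shifted_mean mh h0) _.
Qed.

Let mSD D : measurable D -> measurable (S @^-1` D).
Proof. by move=> mD; exact: measurable_funPTI. Qed.

Let mzD D : measurable D -> measurable (zeta @^-1` D).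
Proof. by move=> mD; exact: measurable_funPTI. Qed.

Let mShift D x : measurable D -> measurable [set w | D (x + S w)%R].
Proof.
move=> mD; apply: (mSD (D := (fun s => x + s)%R @^-1` D)).
rewrite -[X in measurable X]setTI.
by have : measurable_fun setT (fun s : R => x + s)%R; [exact: measurable_funD|exact].
Qed.

Let indic_shift D x : measurable D ->
  \int[P]_w (\1_D (x + S w)%R)%:E = P [set w | D (x + S w)%R].
Proof.
move=> mD; transitivity (P ([set w | D (x + S w)%R] `&` setT)).
  by apply: integral_indic => //; exact: mShift.
by rewrite setIT.
Qed.

Lemma measurable_shift_prob D : measurable D ->
  measurable_fun setT (fun x : R => P [set w | D (x + S w)%R]).
Proof.
move=> mD.
rewrite (_ : (fun x => _) = fun x => \int[P]_w (EFin \o \1_D) (x + S w)%R).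
  apply: measurable_shifted_mean => [|x]; last by rewrite lee_fin.
  by apply/measurable_EFinP; exact: measurable_indic.
by apply/funext => x; rewrite -indic_shift.
Qed.

Lemma renewal_prob (A : set R) : measurable A ->
  P (S @^-1` A) = P (zeta @^-1` A `&` E1) +
    \int[P]_(w in E0) P [set w' | A (zeta w + S w')%R].
Proof.
move=> mA.
have mh : measurable_fun setT (fun x => (\1_A x)%:E : \bar R).
  by apply/measurable_EFinP; exact: measurable_indic.
have h0 x : 0 <= (\1_A x)%:E :> \bar R by rewrite lee_fin.
have := renewal_equation0 mh h0.
rewrite (_ : \int[P]_w _ = P (S @^-1` A)); last first.
  by rewrite -[in RHS](setIT (S @^-1` A)) -integral_indic//; exact: mSD.
move=> ->; congr (_ + _).
  by rewrite -integral_indic//; exact: mzD.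
by apply: eq_integral => w _; rewrite indic_shift.
Qed.

(** If [p] is the probability that [S < 0], the renewal equation gives
    [p <= (1 - q) * p], because adding [zeta >= 0] can only shrink the event. *)
Lemma stopped_sum_lt0_null : P (~` [set w | (0 <= S w)%R]) = 0.
Proof.
pose D : set R := [set` `]-oo, 0%R[].
have mD : measurable D by exact: measurable_itv.
have -> : ~` [set w | (0 <= S w)%R] = S @^-1` D.
  by apply/seteqP; split => w /=; rewrite /D /= in_itv/= ltNge => /negP.
set p := P _.
have pfin : p \is a fin_num by rewrite fin_num_measure//; exact: mSD.
have p0 : 0 <= p by exact: measure_ge0.
suff : p <= (1 - q)%:E * p.
  rewrite -(fineK pfin) -EFinM lee_fin => h.
  have p0' : (0 <= fine p)%R by exact: fine_ge0.
  by congr EFin; case/andP: q01 => *; nra.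
rewrite {1}/p renewal_prob//.
rewrite [X in X + _](_ : _ = 0) ?add0e; last first.
  apply/eqP; rewrite eq_le measure_ge0 andbT -zeta_lt0_null le_measure ?inE//.
  - by apply: measurableI => //; exact: mzD.
  - exact: measurableC.
  - by move=> w /= []; rewrite /D /= in_itv/= => + _ => /lt_geF ->.
have mpre : measurable_fun setT (fun w => P [set w' | D (zeta w + S w')%R]).
  exact: measurableT_comp (measurable_shift_prob mD) _.
rewrite (ge0_integral_conull mZ mE0 zeta_lt0_null)//.
apply: (@le_trans _ _ (\int[P]_(w in E0 `&` Z) cst p w)).
  apply: ge0_le_integral => //.
  - exact: measurableI.
  - exact: measurable_funTS.
  - move=> w [_ /= zw]; rewrite le_measure ?inE//; [exact: mShift|exact: mSD|].
    by move=> w' /=; rewrite /D /= !in_itv/=; lra.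
rewrite integral_cst; last exact: measurableI.
rewrite muleC -eps0; apply: lee_wpmul2r => //.
by rewrite le_measure ?inE//; exact: measurableI.
Qed.

Lemma ccdfE (X : {RV P >-> R}) u :
  (1 - lcdf P X u)%:E = P (X @^-1` [set` `[u, +oo[]).
Proof.
have mX : measurable (X @^-1` [set` `]-oo, u[]).
  exact: measurable_funPTI.
have -> : X @^-1` [set` `[u, +oo[] = ~` (X @^-1` [set` `]-oo, u[]).
  by apply/seteqP; split => w /=; rewrite !in_itv/= andbT leNgt => /negP.
rewrite probability_setC// EFinB /lcdf fineK; last first.
  by rewrite fin_num_measure// -[X in measurable X]set_itvNyo.
by congr (_ - P _); apply/seteqP; split => w /=; rewrite in_itv.
Qed.

(** The renewal equation for the indicator of [[t, +oo[]. The part of its integral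
    over [zeta >= t], where the shifted tail equals [1], completes
    [P(zeta >= t, eps = 1)] to the tail of [zeta]. *)
Lemma tail_equation t : (0 <= t)%R ->
  (1 - lcdf P S t)%:E = (1 - lcdf P zeta t)%:E +
    \int[law_on zeta eps 0]_(x in `[0%R, t[) (1 - lcdf P S (t - x))%:E.
Proof.
move=> t0.
pose tail u : \bar R := (1 - lcdf P S u)%:E.
have tailE u : tail u = P (S @^-1` [set` `[u, +oo[]) by exact: ccdfE.
have tail0 u : 0 <= tail u by rewrite tailE.
have tail1 u : (u <= 0)%R -> tail u = 1.
  move=> u0; apply/eqP; rewrite eq_le; apply/andP; split.
    by rewrite tailE; exact/probability_le1/mSD.
  rewrite tailE -[1](sube0) -stopped_sum_lt0_null -probability_setC ?setCK//; last first.
    by apply: measurableC; exact: measurable_ge0.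
  rewrite le_measure ?inE//; [exact: measurable_ge0|exact: mSD|].
  by move=> w /= S0; rewrite in_itv/= andbT (le_trans u0).
have mI : measurable [set` `[t, +oo[] := measurable_itv _.
have tail_shift x : P [set w | [set` `[t, +oo[] (x + S w)%R] = tail (t - x)%R.
  rewrite tailE; congr (P _); apply/seteqP; split => w' /=;
  by rewrite !in_itv/= !andbT lerBlDl.
have mtail : measurable_fun setT (fun x : R => tail (t - x)%R).
  by under eq_fun do rewrite -tail_shift; exact: measurable_shift_prob.
have mtailz : measurable_fun setT (fun w => tail (t - zeta w)%R).
  exact: measurableT_comp mtail _.
rewrite -!/(tail _) tailE renewal_prob//.
under eq_integral do rewrite tail_shift.
rewrite (ge0_integral_conull mZ mE0 zeta_lt0_null)//.
pose L := zeta @^-1` [set` `[0%R, t[].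
pose G := zeta @^-1` [set` `[t, +oo[].
have mL : measurable L by exact: mzD.
have mG : measurable G by exact: mzD.
have -> : E0 `&` Z = (E0 `&` L) `|` (E0 `&` G).
  rewrite -setIUr; congr (_ `&` _); apply/seteqP; split => w /=.
    by rewrite /L /G /= !in_itv/= andbT => ->; case: (ltP (zeta w) t); [left|right].
  by rewrite /L /G /= !in_itv/= andbT => -[/andP[]//|]; exact: le_trans.
rewrite ge0_integral_setU//; last 4 first.
- exact: measurableI.
- exact: measurableI.
- exact: measurable_funTS.
- apply/disj_setPS => w [[_ +] [_]]; rewrite /L /G /= !in_itv/= andbT.
  by move=> /andP[_ /lt_geF ->].
rewrite [X in _ + (_ + X)](_ : _ = P (G `&` E0)); last first.
  transitivity (\int[P]_(w in E0 `&` G) cst 1 w).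
    apply: eq_integral => w; rewrite inE => -[_]; rewrite /G /= in_itv/= andbT.
    by move=> tz; rewrite tail1// subr_le0.
  by rewrite integral_cst ?mul1e 1?setIC//; exact: measurableI.
rewrite addeCA addeC; congr (_ + _).
  rewrite ccdfE; transitivity (\int[P]_w (\1_G w)%:E); last first.
    by rewrite integral_indic// setIT.
  rewrite integral_split ?integral_indic//.
  by apply/measurable_EFinP; exact: measurable_indic.
by rewrite (@integral_law_on _ _ _ P zeta eps 0%R _ (fun x : R => tail (t - x)%R))// setIC.
Qed.


(** For [h x = exp (- (z * x))] the mean of [h (zeta + S)] factorises. *)
Lemma laplace_equation z : (0 <= z)%R ->
  laplace (distribution P S) z =
  ((laplace (distribution P zeta) z - laplace (law_on zeta eps 0) z) /
   (1 - laplace (law_on zeta eps 0) z))%R.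
Proof.
move=> z0.
pose e (x : R) : \bar R := (expR (- (z * x)))%:E.
have me : measurable_fun setT e.
  apply/measurable_EFinP; apply: measurableT_comp => //.
  by apply: measurableT_comp => //; exact: measurable_funM.
have e0 x : 0 <= e x by rewrite lee_fin expR_ge0.
have eD x y : e (x + y)%R = e x * e y by rewrite /e mulrDr opprD expRD.
have mI : measurable [set` `[0%R, +oo[ : interval R] := measurable_itv _.
have mez : measurable_fun setT (fun w => e (zeta w)) by exact: measurableT_comp.
have meS : measurable_fun setT (fun w => e (S w)) by exact: measurableT_comp.
have preI (X : T -> R) : X @^-1` [set` `[0%R, +oo[] = [set w | (0 <= X w)%R].
  by apply/seteqP; split => w /=; rewrite in_itv/= andbT.
(* negative values are null, so the transforms over [0, +oo[ are plain means *)
have lapS : laplace (distribution P S) z = fine (\int[P]_w e (S w)).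
  rewrite /laplace /Rintegral; congr fine.
  rewrite ge0_integral_pushforward//; last exact: measurable_funTS.
  rewrite preI [RHS](ge0_integral_conull (measurable_ge0 S) measurableT stopped_sum_lt0_null)//.
  by rewrite setTI.
have lapz : laplace (distribution P zeta) z = fine (\int[P]_w e (zeta w)).
  rewrite /laplace /Rintegral; congr fine.
  rewrite ge0_integral_pushforward//; last exact: measurable_funTS.
  by rewrite preI [RHS](ge0_integral_conull mZ measurableT zeta_lt0_null)// setTI.
have lap0 : laplace (law_on zeta eps 0) z = fine (\int[P]_(w in E0) e (zeta w)).
  rewrite /laplace /Rintegral; congr fine.
  rewrite integral_law_on// preI setIC.
  by rewrite [RHS](ge0_integral_conull mZ mE0 zeta_lt0_null).
have e_le1 (X : {RV P >-> R}) D : measurable D -> P (~` [set w | (0 <= X w)%R]) = 0 ->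
    \int[P]_(w in D) e (X w) <= P D.
  move=> mD X0; have mX := measurable_ge0 X.
  have meX : measurable_fun setT (fun w => e (X w)) by exact: measurableT_comp.
  rewrite (ge0_integral_conull mX mD X0)//.
  apply: (@le_trans _ _ (\int[P]_(w in D `&` [set w | (0 <= X w)%R]) cst 1 w)).
    apply: ge0_le_integral => //; [exact: measurableI|exact: measurable_funTS|].
    move=> w [_ /= Xw]; rewrite lee_fin -expR0 ler_expR oppr_le0.
    exact: mulr_ge0.
  rewrite integral_cst ?mul1e; last exact: measurableI.
  by rewrite le_measure ?inE//; exact: measurableI.
have := renewal_equation0 me e0.
have := integral_split mez (fun w => e0 _).
rewrite lapS lapz lap0.
have S_fin : \int[P]_w e (S w) \is a fin_num.
  rewrite ge0_fin_numE; last exact: integral_ge0.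
  apply: le_lt_trans (e_le1 S _ measurableT stopped_sum_lt0_null) _.
  by rewrite ltey_eq fin_num_measure.
have zE_fin D : measurable D -> \int[P]_(w in D) e (zeta w) \is a fin_num.
  move=> mD; rewrite ge0_fin_numE; last exact: integral_ge0.
  apply: le_lt_trans (e_le1 zeta _ mD zeta_lt0_null) _.
  by rewrite ltey_eq fin_num_measure.
have -> : \int[P]_(w in E0) \int[P]_w' e (zeta w + S w')%R =
    \int[P]_(w in E0) e (zeta w) * \int[P]_w e (S w).
  rewrite -(fineK S_fin) [RHS]muleC -ge0_integralZl//; last 2 first.
  - exact: measurable_funTS.
  - by rewrite fineK//; exact: integral_ge0.
  apply: eq_integral => w _; rewrite fineK// muleC -ge0_integralZl//.
  by apply: eq_integral => w' _; rewrite eD.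
have : (fine (\int[P]_(w in E0) e (zeta w)) <= 1 - q)%R.
  by rewrite -lee_fin fineK ?zE_fin// -eps0; exact: (e_le1 zeta E0 mE0 zeta_lt0_null).
rewrite -(fineK S_fin) -(fineK (zE_fin _ mE0)) -(fineK (zE_fin _ mE1)).
rewrite -(fineK (zE_fin _ measurableT)) -EFinM -!EFinD /=.
set p0 := fine (\int[P]_(w in E0) _); set p1 := fine (\int[P]_(w in E1) _).
set p := fine (\int[P]_w e (zeta w)); set s := fine (\int[P]_w e (S w)).
move=> p0q [pE] [sE].
have p0_lt1 : (1 - p0 != 0)%R by case/andP: q01 => *; rewrite lt0r_neq0//; lra.
by apply: (canRL (mulfK p0_lt1)); rewrite pE mulrBr mulr1 {1}sE; ring.
Qed.

(** The weight [q] in Young's inequality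
    [(x + s) ^ 2 <= (1 + q^-1) x ^ 2 + (1 + q) s ^ 2] makes the coefficient of
    [s ^ 2], once multiplied by [P(eps <> 1) = 1 - q], equal to [1 - q ^ 2 < 1]. *)
Lemma truncated_sqr_le (K x s : R) : (0 <= K)%R ->
  (Num.min ((x + s) ^+ 2) K <=
   (1 + q^-1) * x ^+ 2 + (1 + q) * Num.min (s ^+ 2) K)%R.
Proof.
move=> K0; case/andP: q01 => q0 q1.
have x2 : (0 <= (1 + q^-1) * x ^+ 2)%R.
  by rewrite mulr_ge0 ?sqr_ge0// addr_ge0// invr_ge0 ltW.
have [sK|Ks] := leP (s ^+ 2)%R K.
  rewrite ge_min; apply/orP; left.
  have -> : ((1 + q^-1) * x ^+ 2 + (1 + q) * s ^+ 2 =
      (x + s) ^+ 2 + q^-1 * (x - q * s) ^+ 2)%R by field; lra.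
  by rewrite lerDl mulr_ge0 ?sqr_ge0// invr_ge0 ltW.
by rewrite ge_min; apply/orP; right; nra.
Qed.

(** The truncated second moment [M] is finite and satisfies
    [M <= (1 + q^-1) * B + (1 - q ^ 2) * M]. *)
Lemma truncated_second_moment_le (K B : R) : (0 <= K)%R ->
  \int[P]_w (zeta w ^+ 2)%:E = B%:E ->
  \int[P]_w (Num.min (S w ^+ 2) K)%:E <= ((1 + q^-1) * B / q ^+ 2)%:E.
Proof.
move=> K0 zB; case/andP: (q01) => q0 q1.
pose h (s : R) : \bar R := (Num.min (s ^+ 2) K)%:E.
have mh : measurable_fun setT h.
  by apply/measurable_EFinP; apply: measurable_minr => //; exact: measurable_funX.
have h0 s : 0 <= h s by rewrite lee_fin le_min sqr_ge0.
have mhS : measurable_fun setT (fun w => h (S w)) by exact: measurableT_comp.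
have mz2 : measurable_fun setT (fun w => (zeta w ^+ 2)%:E : \bar R).
  by apply/measurable_EFinP; exact: measurable_funX.
have z20 w : 0 <= (zeta w ^+ 2)%:E :> \bar R by rewrite lee_fin sqr_ge0.
set M := (X in X <= _); have ME : M = \int[P]_w h (S w) by [].
have M0 : 0 <= M by apply: integral_ge0 => w _; exact: h0.
have M_fin : M \is a fin_num.
  rewrite ge0_fin_numE//; apply: (@le_lt_trans _ _ (\int[P]_w cst K%:E w)).
    apply: ge0_le_integral => // w _; first exact: h0.
    by rewrite lee_fin ge_min lexx orbT.
  by rewrite integral_cst// lte_mul_pinfty ?lee_fin// ltey_eq fin_num_measure.
set c : R := (1 + q^-1)%R.
have c0 : (0 <= c)%R by rewrite addr_ge0// invr_ge0 ltW.
have c1 : (1 <= c)%R by rewrite lerDl invr_ge0 ltW.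
have q10 : (0 <= 1 + q)%R by rewrite addr_ge0// ltW.
have inner w : \int[P]_w' h (zeta w + S w')%R <=
    c%:E * (zeta w ^+ 2)%:E + (1 + q)%:E * M.
  apply: (@le_trans _ _
    (\int[P]_w' (cst (c * zeta w ^+ 2)%:E w' + (1 + q)%:E * h (S w')))).
    apply: ge0_le_integral => //.
    - apply: measurableT_comp => //; exact: measurable_funD.
    - by apply: emeasurable_funD => //; exact: measurable_funeM.
    - by move=> w' _; rewrite /h -EFinM -EFinD lee_fin truncated_sqr_le.
  rewrite ge0_integralD//; last 3 first.
  - by move=> w' _; rewrite lee_fin mulr_ge0// sqr_ge0.
  - by move=> w' _; rewrite mule_ge0.
  - exact: measurable_funeM.
  rewrite integral_cst//= probability_setT mule1 EFinM leeD2l//.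
  by rewrite ge0_integralZl.
have : M <= \int[P]_(w in E1) (c%:E * (zeta w ^+ 2)%:E) +
    \int[P]_(w in E0) (c%:E * (zeta w ^+ 2)%:E + (1 + q)%:E * M).
  rewrite {1}ME (renewal_equation0 mh h0); apply: leeD.
    apply: ge0_le_integral => //.
    - by apply: measurable_funTS; exact: measurableT_comp.
    - by apply: measurable_funTS; exact: measurable_funeM.
    - move=> w _; rewrite /h -EFinM lee_fin; have := sqr_ge0 (zeta w).
      by rewrite ge_min => ?; apply/orP; left; nra.
  apply: ge0_le_integral => //.
  - by move=> w _; exact: integral_ge0.
  - apply: measurable_funTS; exact: measurableT_comp (measurable_shifted_mean mh h0) _.
  - by apply: measurable_funTS; apply: emeasurable_funD => //; exact: measurable_funeM.
rewrite ge0_integralD//; last 3 first.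
- by move=> w _; rewrite mule_ge0.
- by apply: measurable_funTS; exact: measurable_funeM.
- by move=> w _; rewrite mule_ge0.
rewrite addeA -integral_split//; last 2 first.
- exact: measurable_funeM.
- by move=> w; rewrite mule_ge0.
rewrite [X in _ <= X + _]ge0_integralZl// zB integral_cst//=.
rewrite (eps0 : P E0 = _) -(fineK M_fin) -!EFinM -EFinD !lee_fin.
set m := fine M => h1.
rewrite ler_pdivlMr ?exprn_gt0//; nra.
Qed.

Lemma second_moment_lty (B : R) :
  \int[P]_w (zeta w ^+ 2)%:E = B%:E -> \int[P]_w (S w ^+ 2)%:E < +oo.
Proof.
move=> zB.
pose g n w : \bar R := (Num.min (S w ^+ 2) n%:R)%:E.
have mg n : measurable_fun setT (g n).
  apply/measurable_EFinP; apply: measurable_minr => //; exact: measurable_funX.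
have g0 n w : 0 <= g n w by rewrite lee_fin le_min sqr_ge0/=.
have ndg w : {homo g^~ w : n m / (n <= m)%N >-> n <= m}.
  by move=> n m nm; rewrite lee_fin le_min2// ler_nat.
have limg w : limn (g^~ w) = (S w ^+ 2)%:E.
  apply/cvg_lim => //; apply: cvg_near_cst.
  near=> n; congr EFin; apply/min_idPl.
  by near: n; exact: nbhs_infty_ger.
have -> : \int[P]_w (S w ^+ 2)%:E = limn (fun n => \int[P]_w g n w).
  rewrite -monotone_convergence//.
  by apply: eq_integral => w _; rewrite limg.
apply: (@le_lt_trans _ _ ((1 + q^-1) * B / q ^+ 2)%:E); last exact: ltry.
apply: lime_le.
  by apply: ereal_nondecreasing_is_cvgn => n m nm; apply: ge0_le_integral => // w _;
    exact: ndg.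
by near=> n; exact: truncated_second_moment_le.
Unshelve. all: by end_near.
Qed.

(** The renewal equation for [|x|] and [x ^ 2], with means [m] and [v] of
    [|S|] and [S ^ 2]: since [zeta] and [S] are almost surely nonnegative,
    [m = a + (1 - q) * m] and [v = B + 2 * m * a0 + (1 - q) * v]. *)
Lemma moments_equation (a a0 B : R) :
  \int[P]_w `|zeta w|%:E = a%:E ->
  \int[P]_(w in E0) `|zeta w|%:E = a0%:E ->
  \int[P]_w (zeta w ^+ 2)%:E = B%:E ->
  \int[P]_w `|S w|%:E = (a / q)%:E /\
  \int[P]_w (S w ^+ 2)%:E = ((B + 2 * a0 * (a / q)) / q)%:E.
Proof.
move=> za za0 zB; case/andP: (q01) => q0 q1.
have mnorm : measurable_fun setT (fun x : R => `|x|%:E : \bar R).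
  by apply/measurable_EFinP; exact: normr_measurable.
have norm0 (x : R) : 0 <= `|x|%:E :> \bar R by rewrite lee_fin.
have msqr : measurable_fun setT (fun x : R => (x ^+ 2)%:E : \bar R).
  by apply/measurable_EFinP; exact: measurable_funX.
have sqr0 (x : R) : 0 <= (x ^+ 2)%:E :> \bar R by rewrite lee_fin sqr_ge0.
have mnS : measurable_fun setT (fun w => `|S w|%:E : \bar R).
  exact: measurableT_comp mnorm _.
have msS : measurable_fun setT (fun w => (S w ^+ 2)%:E : \bar R).
  exact: measurableT_comp msqr _.
have mnz : measurable_fun setT (fun w => `|zeta w|%:E : \bar R).
  exact: measurableT_comp mnorm _.
have msz : measurable_fun setT (fun w => (zeta w ^+ 2)%:E : \bar R).
  exact: measurableT_comp msqr _.
have v_lty := second_moment_lty zB.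
have v_fin : \int[P]_w (S w ^+ 2)%:E \is a fin_num.
  by rewrite ge0_fin_numE// integral_ge0.
have m_fin : \int[P]_w `|S w|%:E \is a fin_num.
  rewrite ge0_fin_numE; last exact: integral_ge0.
  exact: norm_integral_lty v_lty.
set m := fine (\int[P]_w `|S w|%:E); set v := fine (\int[P]_w (S w ^+ 2)%:E).
have mE : \int[P]_w `|S w|%:E = m%:E by rewrite fineK.
have vE : \int[P]_w (S w ^+ 2)%:E = v%:E by rewrite fineK.
have innerm x : (0 <= x)%R -> \int[P]_w `|x + S w|%:E = `|x|%:E + m%:E.
  move=> x0; rewrite (@ge0_integral_eq_on_ge0 _ _ _ _ S _ (fun s => `|x + s|%:E)
    (fun s => cst `|x|%:E s + `|s|%:E))//.
  - by rewrite ge0_integralD//= mE integral_cst//= probability_setT mule1.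
  - exact: stopped_sum_lt0_null.
  - by apply: (measurableT_comp mnorm); exact: measurable_funD.
  - exact: emeasurable_funD.
  - by move=> s; exact: adde_ge0 (norm0 x) (norm0 s).
  - by move=> s s0; rewrite -EFinD !ger0_norm// addr_ge0.
have m0 : (0 <= m)%R by apply: fine_ge0; exact: integral_ge0.
have v0 : (0 <= v)%R by apply: fine_ge0; exact: integral_ge0.
have innerv x : (0 <= x)%R -> \int[P]_w ((x + S w) ^+ 2)%:E =
    ((x ^+ 2)%:E + (2 * m)%:E * `|x|%:E) + v%:E.
  move=> x0; have x20 : (0 <= 2 * x)%R by rewrite mulr_ge0.
  rewrite (@ge0_integral_eq_on_ge0 _ _ _ _ S _ (fun s => ((x + s) ^+ 2)%:E)
    (fun s => (cst (x ^+ 2)%:E s + (2 * x)%:E * `|s|%:E) + (s ^+ 2)%:E))//.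
  - rewrite ge0_integralD//; last 2 first.
    + by move=> w _; apply: adde_ge0; [exact: sqr0|rewrite mule_ge0].
    + by apply: emeasurable_funD => //; exact: measurable_funeM.
    rewrite ge0_integralD//; last 3 first.
    + by move=> w _; exact: sqr0.
    + by move=> w _; rewrite mule_ge0.
    + exact: measurable_funeM.
    rewrite ge0_integralZl//= mE vE integral_cst//= probability_setT mule1.
    by rewrite -!EFinM ger0_norm// mulrAC.
  - exact: stopped_sum_lt0_null.
  - by apply: (measurableT_comp msqr); exact: measurable_funD.
  - apply: emeasurable_funD => //; apply: emeasurable_funD => //.
    exact: measurable_funeM.
  - move=> s; apply: adde_ge0 => //; apply: adde_ge0; first exact: sqr0.
    by rewrite mule_ge0.
  - by move=> s s0; rewrite -EFinM -!EFinD !ger0_norm//; congr EFin; ring.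
have := renewal_equation0 mnorm norm0.
rewrite (@ge0_integral_eq_on_ge0 _ _ _ _ zeta E0 (fun x => \int[P]_w `|x + S w|%:E)
    (fun x => `|x|%:E + cst m%:E x))//; last 5 first.
- exact: zeta_lt0_null.
- exact: measurable_shifted_mean mnorm norm0.
- by move=> x; exact: integral_ge0.
- exact: emeasurable_funD.
- by move=> x; apply: adde_ge0; [exact: norm0|rewrite lee_fin].
rewrite ge0_integralD//; last exact: measurable_funTS.
rewrite addeA -integral_split// za mE integral_cst//= (eps0 : P E0 = _).
rewrite -EFinM -EFinD => -[mq].
have := renewal_equation0 msqr sqr0.
rewrite (@ge0_integral_eq_on_ge0 _ _ _ _ zeta E0 (fun x => \int[P]_w ((x + S w) ^+ 2)%:E)
    (fun x => ((x ^+ 2)%:E + (2 * m)%:E * `|x|%:E) + cst v%:E x))//; last 5 first.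
- exact: zeta_lt0_null.
- exact: measurable_shifted_mean msqr sqr0.
- by move=> x; exact: integral_ge0.
- apply: emeasurable_funD => //; apply: emeasurable_funD => //.
  exact: measurable_funeM.
- move=> x; apply: adde_ge0; last by rewrite lee_fin.
  by apply: adde_ge0; [exact: sqr0|rewrite mule_ge0// lee_fin mulr_ge0].
rewrite ge0_integralD//; last 2 first.
- move=> w _; apply: adde_ge0; first exact: sqr0.
  by rewrite mule_ge0// lee_fin mulr_ge0.
- apply: measurable_funTS; apply: emeasurable_funD => //.
  exact: measurable_funeM.
rewrite ge0_integralD//; last 3 first.
- exact: measurable_funTS.
- by move=> w _; rewrite mule_ge0// lee_fin mulr_ge0.
- by apply: measurable_funTS; exact: measurable_funeM.
rewrite ge0_integralZl//; last 2 first.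
- exact: measurable_funTS.
- by rewrite lee_fin mulr_ge0.
rewrite 2!addeA -integral_split// zB za0 vE integral_cst//= (eps0 : P E0 = _).
rewrite -!EFinM -!EFinD => -[vq].
have mQ : m = (a / q)%R by apply: (canRL (mulfK (lt0r_neq0 q0))); nra.
split; first by rewrite mQ.
rewrite -mQ; congr EFin.
by apply: (canRL (mulfK (lt0r_neq0 q0))); nra.
Qed.

Lemma moments_of_sum : 'V_P[zeta] < +oo ->
  let sigma2 := fine 'V_P[zeta] in
  let a := fine 'E_P[zeta] in
  let a0 := fine 'E_P[(zeta \* \1_E0)%R] in
  'E_P[S] = (a / q)%R%:E /\
  'V_P[S] = (sigma2 / q + (a ^+ 2 * (q - 1) + 2 * a * a0) / q ^+ 2)%R%:E.
Proof.
move=> V; have zlty := sqr_integral_lty V; have nlty := norm_integral_lty zlty.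
have mnz : measurable_fun setT (fun w => `|zeta w|%:E : \bar R).
  by apply/measurable_EFinP; exact: measurableT_comp.
have n_fin D : measurable D -> \int[P]_(w in D) `|zeta w|%:E \is a fin_num.
  move=> mD; rewrite ge0_fin_numE; last exact: integral_ge0.
  apply: le_lt_trans nlty; apply: ge0_subset_integral => //.
have z_fin : \int[P]_w (zeta w ^+ 2)%:E \is a fin_num.
  by rewrite ge0_fin_numE//; apply: integral_ge0 => w _; rewrite lee_fin sqr_ge0.
have za := esym (fineK (n_fin _ measurableT)).
have za0 := esym (fineK (n_fin _ mE0)).
have zB := esym (fineK z_fin).
have [Sm Sv] := moments_equation za za0 zB.
have [zE zV] := nonneg_moments zeta_lt0_null za zB.
have [SE SV] := nonneg_moments stopped_sum_lt0_null Sm Sv.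
have E0E : 'E_P[(zeta \* \1_E0)%R] = \int[P]_(w in E0) `|zeta w|%:E.
  have mX : measurable_fun setT (zeta \* \1_E0)%R.
    by apply: measurable_funM => //; exact: measurable_indic.
  rewrite (@expectation_norm _ _ _ P (mfun_Sub (mem_set mX))) /=.
    rewrite [RHS]integral_mkcond; apply: eq_integral => w _.
    rewrite /patch indicE; case: ifPn => wE0; first by rewrite mulr1.
    by rewrite mulr0 normr0.
  apply/eqP; rewrite eq_le measure_ge0 andbT -zeta_lt0_null le_measure ?inE//.
  - by apply: measurableC; exact: (measurable_ge0 (mfun_Sub (mem_set mX))).
  - exact: measurableC.
  - by move=> w /= zw z0; apply: zw; rewrite mulr_ge0.
move=> sigma2 a a0; rewrite SE SV /sigma2 /a /a0 E0E zE zV /=.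
split => //; congr EFin.
have q_neq0 : q != 0%R by case/andP: q01 => q0 _; exact: lt0r_neq0.
move: (fine _) (fine _) (fine _) => x y z; field; exact: q_neq0.
Qed.

End consequences.

Theorem proposition2p1 (d : measure_display) (T : measurableType d)
    (R : realType) (P : probability T R)
    (zeta eps : {RV P >-> R}) (zeta_ eps_ : nat -> {RV P >-> R}) (q : R)
    (q01 : 0 < q < 1)
    (eps1 : P [set w | eps w = 1] = q%:E)
    (eps0 : P [set w | eps w = 0] = (1 - q)%:E)
    (zeta_ge0 : P [set w | 0 <= zeta w] = 1%E)
    (zeta_neq0 : (P [set w | zeta w = 0%R] < 1)%E)
    (copies : forall n, (1 <= n)%N ->
       same_law P (fun w => (zeta_ n w, eps_ n w)) (fun w => (zeta w, eps w)))
    (indep : mutually_independent P [set n : nat | (1 <= n)%N]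
       (fun n w => (zeta_ n w, eps_ n w))) :
  let S : {RV P >-> R} := stopped_sum zeta_ eps_ in
  let F_zeta := lcdf P zeta in
  let F_S := lcdf P S in
  let P_S := fun t : R => 1 - F_S t in
  let dF_zeta := distribution P zeta in
  let dF_zeta0 := law_on zeta eps 0 in
  let dF_S := distribution P S in
  [/\ (forall t : R, 0 <= t ->
         (P_S t)%:E =
         ((1 - F_zeta t)%:E + \int[dF_zeta0]_(x in `[0%R, t[) (P_S (t - x)%R)%:E)%E),
      (forall z : R, 0 <= z ->
         let psi := laplace dF_zeta in
         let psi0 := laplace dF_zeta0 in
         let phi := laplace dF_S in
         phi z = (psi z - psi0 z) / (1 - psi0 z)) &
      (('V_P[zeta] < +oo)%E ->
         let sigma2 := fine ('V_P[zeta])%E in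
         let a := fine ('E_P[zeta])%E in
         let a0 := fine ('E_P[zeta \* \1_[set w | eps w = 0%R]])%E in
         ('E_P[S] = (a / q)%R%:E)%E /\
         ('V_P[S] = (sigma2 / q + (a ^+ 2 * (q - 1) + 2 * a * a0) / q ^+ 2)%R%:E)%E)].
Proof.
split.
- exact: (tail_equation q01 eps1 eps0 zeta_ge0 copies indep).
- exact: (laplace_equation q01 eps1 eps0 zeta_ge0 copies indep).
- exact: (moments_of_sum q01 eps1 eps0 zeta_ge0 copies indep).
Qed.
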